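(* Let $1\le r\le d$, let $\Delta$ be a balanced homology $(d-1)$-sphere over a field $\mathbf{k}$ with color set $[d]$ having the balanced $(r-1)$-stacked property, let $\mathcal X$ be an $(r-1)$-stacked cross-polytopal decomposition of $\Delta$, and let $m$ be the number of $d$-dimensional cells of $\mathcal X$. If $T\subseteq[d]$ and $r-1\le|T|\le d-r+1$, then $h_T(\Delta)=m$.
   Context: Balanced: vertex coloring $\kappa:V\to[d]$ with no face containing two vertices of the same color. For $S\subseteq[d]$, $f_S(\Delta)$ is the number of faces $F$ with $\kappa(F)=S$, and the flag $h$-numbers are $h_T(\Delta)=\sum_{S\subseteq T}(-1)^{|T|-|S|}f_S(\Delta)$. $\mathbf{k}$-homology $(d-1)$-sphere: $\widetilde H_*(\mathrm{lk}_\Delta F;\mathbf{k})\cong\widetilde H_*(\mathbb{S}^{d-|F|-1};\mathbf{k})$ for all faces $F$ including $\emptyset$. A $d$-dimensional cross-polytopal complex is a regular CW complex whose $(d-1)$-skeleton is a simplicial complex, each $d$-cell has boundary a copy of the boundary complex of the $d$-cross-polytope, and no two $d$-cells share a vertex set. An $(r-1)$-stacked cross-polytopal decomposition of $\Delta$ is such a complex $\mathcal X$ which is a homology $d$-ball (for each point $p$ the pair $(\|\mathcal X\|,\|\mathcal X\|-p)$ has relative $\mathbf{k}$-homology of a $d$-ball or $d$-sphere, $\|\mathcal X\|$ is $\mathbf{k}$-acyclic, and the boundary complex is a homology $(d-1)$-sphere), whose boundary complex (faces $F$ with vanishing local homology $H_*(\|\mathcal X\|,\|\mathcal X\|-p;\mathbf{k})$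 at points $p$ in the relative interior of $F$) equals $\Delta$, and all of whose faces of dimension $\le d-r$ are faces of $\Delta$. $\Delta$ has the balanced $(r-1)$-stacked property if such $\mathcal X$ exists. *)

(* Defs.v *)
From HB Require Import structures.
From mathcomp Require Import all_boot all_order all_algebra.

Set Implicit Arguments.
Unset Strict Implicit.
Unset Printing Implicit Defensive.

Import Order.TTheory GRing.Theory Num.Theory.
Local Open Scope ring_scope.

(* A simplicial complex always has the empty face. Elements of W that are not
   vertices of K are allowed. *)
Definition simplicial_complex (W : finType) (K : {set {set W}}) : Prop :=
  set0 \in K /\ forall F G : {set W}, F \in K -> G \subset F -> G \in K.

Definition link (W : finType) (K : {set {set W}}) (F : {set W}) : {set {set W}} :=
  [set G : {set W} | [disjoint F & G] & F :|: G \in K].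

Section Homology.
Variables (k : fieldType) (W : finType).
Implicit Types (A K L : {set {set W}}).

Definition chain_space : vectType k := {ffun {set W} -> k^o}.

(* Simplices are oriented by the enumeration of W: the facet F :\ v of F occurs
   in the boundary of F with sign (-1)^j, where j is the number of vertices of F
   that precede v. *)
Definition facet_sign (v : W) (G : {set W}) : k :=
  (-1) ^+ #|[set u in G | (enum_rank u < enum_rank v)%N]|.

Definition boundary_fun A (c : chain_space) : chain_space :=
  [ffun G => if G \in A then \sum_(v | v \notin G) facet_sign v G * c (v |: G)
             else 0].

Lemma boundary_fun_is_linear A : linear (boundary_fun A).
Proof.
move=> a c e; apply/ffunP => G; rewrite !ffunE.
case: ifP => _; last by rewrite scaler0 addr0.
rewrite scaler_sumr -big_split /=; apply: eq_bigr => v _.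
by rewrite !ffunE mulrDr; congr (_ + _); rewrite /GRing.scale /= mulrCA.
Qed.

HB.instance Definition _ A :=
  GRing.isLinear.Build k chain_space chain_space _ (boundary_fun A)
    (boundary_fun_is_linear A).

Definition boundary A : 'End(chain_space) := linfun (boundary_fun A).

Definition simplex_chain (F : {set W}) : chain_space := [ffun G => (G == F)%:R].

Definition chains A (n : nat) : {vspace chain_space} :=
  <<[seq simplex_chain F | F in [set F in A | #|F| == n]]>>%VS.

Definition cycles A n : {vspace chain_space} :=
  (chains A n :&: lker (boundary A))%VS.

Definition boundaries A n : {vspace chain_space} :=
  (boundary A @: chains A n.+1)%VS.

(* C(K, L) = C(K) / C(L) has basis K :\: L. Chains are graded by the number n of
   vertices, so this is the dimension of H_(n-1)(K, L; k). *)
Definition rel_betti K L (n : nat) : nat :=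
  (\dim (cycles (K :\: L) n) - \dim (boundaries (K :\: L) n))%N.

(* The empty face is kept, so this is the dimension of the reduced homology in
   degree n-1, n = 0 being degree -1. *)
Definition red_betti K (n : nat) : nat := rel_betti K set0 n.

End Homology.

(* Homology (d-1)-sphere: the reduced homology of the link of F is k in degree
   d - #|F| - 1, that is n = d - #|F|, and 0 in the other degrees. *)
Definition homology_sphere (k : fieldType) (W : finType) (d : nat)
    (K : {set {set W}}) : Prop :=
  simplicial_complex K /\
  forall F, F \in K -> forall n, red_betti k (link K F) n = (n + #|F| == d)%N.

Section Flag.
Variables (V : finType) (d : nat) (D : {set {set V}}) (kappa : V -> 'I_d).

Definition balanced : Prop :=
  forall F, F \in D -> {in F &, injective kappa}.

Definition flag_f (S : {set 'I_d}) : nat := #|[set F in D | kappa @: F == S]|.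

Definition flag_h (T : {set 'I_d}) : int :=
  \sum_(S : {set 'I_d} | S \subset T) (-1) ^+ (#|T| - #|S|) * (flag_f S)%:Z.

End Flag.

(* The vertices (i, true) and (i, false) are antipodal. *)
Definition cross_polytope_boundary (d : nat) : {set {set 'I_d * bool}} :=
  [set F : {set 'I_d * bool} | [forall i : 'I_d, ~~ (((i, true) \in F) && ((i, false) \in F))]].

Definition cross_polytope_copy (V : finType) (d : nat) (B : {set {set V}}) : Prop :=
  exists2 phi : 'I_d * bool -> V, injective phi &
    B = [set phi @: (F : {set 'I_d * bool}) | F in cross_polytope_boundary d].

(* A regular CW complex is determined, up to cellular homeomorphism, by its face
   poset. As distinct d-cells have distinct vertex sets, a d-cell is determined
   by its boundary complex B, whose vertex set is cover B; the d-cell is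
   represented by B. *)
Record cross_complex (V : finType) (d : nat) := CrossComplex {
  skel : {set {set V}};
  dcells : {set {set {set V}}};
  skel_complex : simplicial_complex skel;
  skel_dim : forall F, F \in skel -> (#|F| <= d)%N;
  dcells_neq0 : dcells != set0;
  dcell_boundary_sub : forall B, B \in dcells -> B \subset skel;
  dcell_boundary_cross : forall B, B \in dcells -> cross_polytope_copy d B;
  dcell_vertices_inj : {in dcells &, injective (@cover V)}
}.

(* A face is a simplex (inl) or a d-cell (inr). *)
Definition face (V : finType) : finType := ({set V} + {set {set V}})%type.

Definition face_le (V : finType) (x y : face V) : bool :=
  match x, y with
  | inl F, inl G => F \subset G
  | inl F, inr B => F \in B
  | inr _, inl _ => false
  | inr B, inr B' => B == B'
  end.

Section CrossComplex.
Variables (V : finType) (d : nat) (X : cross_complex V d).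

Definition faces : {set face V} :=
  [set x | match x with inl F => F \in skel X | inr B => B \in dcells X end].

(* dim x + 1 *)
Definition face_rank (x : face V) : nat :=
  match x with inl F => #|F| | inr _ => d.+1 end.

(* The barycentric subdivision: the complex of chains of nonempty faces. Its
   geometric realization is ||X||, the simplex with vertices x_1 < ... < x_j
   having its relative interior in the relative interior of x_j. *)
Definition subdivision : {set {set face V}} :=
  [set s : {set face V} | (s \subset faces :\ inl set0) &&
    [forall x in s, forall y in s, face_le x y || face_le y x]].

(* Every point p of ||X|| is in the relative interior of exactly one nonempty
   simplex s of the subdivision, its carrier, and ||X|| - p deformation retracts
   onto the subcomplex of the simplices that do not contain s. Hence the
   dimension of H_(n-1)(||X||, ||X|| - p; k). *)
Definition local_betti (k : fieldType) (s : {set face V}) (n : nat) : nat :=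
  rel_betti k subdivision [set t in subdivision | ~~ (s \subset t)] n.

Definition is_carrier (s : {set face V}) : Prop :=
  s \in subdivision /\ s != set0.

(* The points of carrier s are in the relative interior of x. *)
Definition carrier_in_relint (s : {set face V}) (x : face V) : Prop :=
  [/\ is_carrier s, x \in s & forall y, y \in s -> face_le y x].

(* The empty face has no points, so it is a boundary face. *)
Definition boundary_face (k : fieldType) (x : face V) : Prop :=
  x \in faces /\
  forall s, carrier_in_relint s x -> forall n, local_betti k s n = 0%N.

Definition boundary_complex_eq (k : fieldType) (D : {set {set V}}) : Prop :=
  forall x, boundary_face k x <-> exists2 F, F \in D & x = inl F.

Definition homology_ball (k : fieldType) : Prop :=
  [/\ forall s, is_carrier s ->
        (forall n, local_betti k s n = 0%N) \/
        (forall n, local_betti k s n = (n == d.+1)),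
      forall n, red_betti k subdivision n = 0%N
    & exists2 D, boundary_complex_eq k D & homology_sphere k d D].

End CrossComplex.

(* X is an (r-1)-stacked cross-polytopal decomposition of D. *)
Definition stacked_decomposition (k : fieldType) (V : finType) (d r : nat)
    (D : {set {set V}}) (X : cross_complex V d) : Prop :=
  [/\ homology_ball X k,
      boundary_complex_eq X k D
    & forall x, x \in faces X -> (face_rank d x <= d - r + 1)%N ->
        exists2 F, F \in D & x = inl F].

(* The balanced (r-1)-stacked property of D. *)
Definition stacked_property (k : fieldType) (V : finType) (d r : nat)
    (D : {set {set V}}) : Prop :=
  exists X : cross_complex V d, stacked_decomposition k r D X.

(* Main.v *)
Require Import Defs.
From HB Require Import structures.
From mathcomp Require Import all_boot all_order all_algebra.
From mathcomp Require Import zify ring.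

(* For F in Delta the local homology of ||X|| at a point of F vanishes, so by
   Euler-Poincare and Moebius inversion over the (Eulerian) face poset,
     sum_(G >= F) (-1)^|G| = (-1)^d #{d-cells containing F},
   where G ranges over the simplices of X; for F = set0 this is the acyclicity of X.
   If X is properly coloured, every face of X with colours in T, |T| <= d - r + 1, is
   in Delta. Multiplying the identity by (-1)^|F|, summing over these F and exchanging
   the sums leaves on the left the simplices with colours in the complement of T, and
   (-1)^(d - |T|) for each d-cell on the right. Hence h_(~T)(Delta) = m.
   The edges of X lie in Delta, which makes X properly coloured, unless d = r = 2;
   there h_T = h_(~T) and a count of vertices suffices. *)

Set Implicit Arguments.
Unset Strict Implicit.
Unset Printing Implicit Defensive.

Import Order.TTheory GRing.Theory Num.Theory.
Local Open Scope ring_scope.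

(** * Relative simplicial chains and the Euler-Poincare formula *)

Section EulerPoincare.
Variables (k : fieldType) (W : finType) (A : {set {set W}}).
Implicit Types (F G : {set W}) (c : chain_space k W).

Lemma span_simplex_chain0 (s : seq {set W}) c F :
  c \in <<[seq simplex_chain k G | G <- s]>>%VS -> F \notin s -> c F = 0.
Proof.
elim: s c => [|G s IHs] c /=.
  by rewrite span_nil memv0 => /eqP -> _; rewrite ffunE.
rewrite span_cons => /memv_addP [u /vlineP [a ->]] [w /IHs Hw ->].
rewrite inE negb_or => /andP [FG Fs]; rewrite !ffunE Hw // addr0.
by rewrite (negbTE FG) /GRing.scale /= mulr0.
Qed.

Lemma chainsP n c :
  reflect (forall F, F \notin [set F in A | #|F| == n] -> c F = 0)
          (c \in chains k A n).
Proof.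
apply: (iffP idP) => [cA F FS | H].
  by apply: (span_simplex_chain0 cA); rewrite mem_enum.
have -> : c = \sum_(F in [set F in A | #|F| == n]) c F *: simplex_chain k F.
  apply/ffunP => F; rewrite sum_ffunE.
  under eq_bigr => G _ do rewrite !ffunE.
  have [FS | FS] := boolP (F \in [set F in A | #|F| == n]).
    rewrite (bigD1 F) //= eqxx /GRing.scale /= mulr1 big1 ?addr0 // => G.
    by case/andP=> _ GF; rewrite eq_sym (negbTE GF) mulr0.
  rewrite H // big1 // => G GS.
  have /negbTE -> : F != G by apply: contraNneq FS => ->.
  by rewrite /GRing.scale /= mulr0.
apply: memv_suml => F FS; apply: memvZ; apply: memv_span.
by apply/imageP; exists F.
Qed.

Lemma dim_chains n : \dim (chains k A n) = #|[set F in A | #|F| == n]|.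
Proof.
have Hfree : forall s : seq {set W}, uniq s ->
    free [seq simplex_chain k F | F <- s].
  elim=> [|F s IHs] /=; first by rewrite nil_free.
  case/andP=> Fs /IHs fs; rewrite free_cons fs andbT.
  apply/negP => /span_simplex_chain0 /(_ Fs) /eqP.
  by rewrite ffunE eqxx oner_eq0.
have /eqP := Hfree _ (enum_uniq [set F in A | #|F| == n]).
by rewrite size_map -cardE => <-.
Qed.

(** Convexity holds for a difference of simplicial complexes. It makes [boundary A] square to zero
    although this map discards the faces outside [A]. *)
Hypothesis A_convex : forall F G H,
  F \in A -> H \in A -> F \subset G -> G \subset H -> G \in A.

(** Inserting [v] moves [w] one position further exactly when [v] precedes [w]. *)
Lemma facet_signU (v w : W) G : v \notin G -> v != w ->
  facet_sign k w (v |: G) =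
  (if (enum_rank v < enum_rank w)%N then -1 else 1) * facet_sign k w G.
Proof.
move=> vG vw; rewrite /facet_sign; case: ifP => Hvw.
  have -> : [set u in v |: G | (enum_rank u < enum_rank w)%N] =
            v |: [set u in G | (enum_rank u < enum_rank w)%N].
    by apply/setP => u; rewrite !inE; case: eqVneq => // ->.
  by rewrite cardsU1 inE (negbTE vG) exprS.
rewrite mul1r; congr (_ ^+ _); apply: eq_card => u; rewrite !inE.
by case: eqVneq => // ->; rewrite Hvw (negbTE vG).
Qed.

Lemma boundary_boundary n c :
  c \in chains k A n -> boundary k A (boundary k A c) = 0.
Proof.
move=> /chainsP Hc; apply/ffunP => G; rewrite !lfunE /= !ffunE.
case: ifP => // GA.
pose a v w := facet_sign k v G * (facet_sign k w (v |: G) * c (w |: (v |: G))).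
have aE v : v \notin G ->
    facet_sign k v G * boundary_fun A c (v |: G) =
    \sum_(w | (w \notin G) && (v != w)) a v w.
  move=> vG; rewrite ffunE; have [vGA | vGA] := boolP (v |: G \in A).
    rewrite mulr_sumr; apply: eq_bigl => w.
    by rewrite !inE negb_or andbC eq_sym.
  (* If [v |: G] is outside [A], then so is [w |: (v |: G)], by convexity and [G \in A]; its
     coefficient in [c] vanishes. *)
  rewrite mulr0 big1 // => w /andP [wG vw]; rewrite /a Hc ?mulr0 //.
  rewrite !inE negb_and; apply/orP; left; apply: contra vGA => wA.
  exact: (A_convex GA wA (subsetUr _ _) (subsetUr _ _)).
rewrite (eq_bigr _ aE) pair_big_dep /=.
have aC v w : v \notin G -> w \notin G -> v != w -> a v w = - a w v.
  move=> vG wG vw; rewrite /a setUCA !facet_signU // 1?eq_sym //.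
  have : enum_rank v != enum_rank w :> nat.
    by apply: contra vw => /eqP /val_inj /enum_rank_inj ->.
  by case: ltngtP => // _ _; ring.
(* Each pair with [v] before [w] is matched with the swapped pair, and [aC] makes the two terms
   cancel. *)
rewrite (bigID (fun p => (enum_rank p.1 < enum_rank p.2)%N)) /=.
rewrite [X in _ + X](reindex (fun p : W * W => (p.2, p.1))) /=; last first.
  by exists (fun p : W * W => (p.2, p.1)) => -[].
rewrite [X in _ + X](eq_bigl (fun p : W * W =>
  [&& p.1 \notin G, p.2 \notin G & p.1 != p.2] &&
  (enum_rank p.1 < enum_rank p.2)%N)).
  rewrite -big_split /= big1 // => -[v w] /= /andP [/and3P [vG wG vw] _].
  by rewrite (aC v w) // addNr.
move=> [v w] /=; rewrite -leqNgt leq_eqVlt (inj_eq val_inj) (inj_eq enum_rank_inj).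
by rewrite (eq_sym w v); case: eqVneq => /=; rewrite ?andbF // andbCA.
Qed.

Lemma boundary_chains n c : c \in chains k A n.+1 -> boundary k A c \in chains k A n.
Proof.
move=> /chainsP Hc; apply/chainsP => G; rewrite lfunE /= ffunE inE negb_and.
case: ifP => //= GA Gn; apply: big1 => v vG; rewrite Hc ?mulr0 //.
by rewrite inE negb_and cardsU1 vG add1n eqSS Gn orbT.
Qed.

Lemma boundaries_sub_cycles n : (boundaries k A n <= cycles k A n)%VS.
Proof.
apply/subvP => _ /memv_imgP [c cA ->]; rewrite memv_cap boundary_chains //=.
by rewrite memv_ker (boundary_boundary cA).
Qed.

(** Rank-nullity for the boundary map on the chains of one degree. *)
Lemma dim_cycles_boundary n :
  (\dim (cycles k A n) + \dim (boundary k A @: chains k A n)%VS)%N =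
  #|[set F in A | #|F| == n]|.
Proof. by rewrite limg_ker_dim dim_chains. Qed.

Lemma boundary_chains0 : (boundary k A @: chains k A 0)%VS = 0%VS.
Proof.
apply/eqP; rewrite -subv0; apply/subvP => _ /memv_imgP [c /chainsP Hc ->].
rewrite memv0; apply/eqP/ffunP => G; rewrite lfunE /= !ffunE.
case: ifP => // _; apply: big1 => v vG; rewrite Hc ?mulr0 //.
by rewrite inE negb_and cardsU1 vG orbT.
Qed.

Lemma sum_sign_card N : (#|W| < N)%N ->
  \sum_(F in A) (-1) ^+ #|F| =
  \sum_(n < N) (-1) ^+ n * #|[set F in A | #|F| == n]|%:Z :> int.
Proof.
move=> WN; rewrite (partition_big (fun F => insubd (Ordinal WN) #|F|) predT) //=.
apply: eq_bigr => n _.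
have cardE F : (insubd (Ordinal WN) #|F| == n) = (#|F| == n).
  by rewrite -(inj_eq val_inj) /= val_insubd (leq_ltn_trans (max_card _) WN).
rewrite (eq_bigr (fun=> (-1) ^+ n)) => [|F]; last by rewrite cardE => /andP [_ /eqP ->].
rewrite sumr_const -mulr_natr natz; congr (_ * Posz _).
by apply: eq_card => F; rewrite !inE unfold_in /= cardE.
Qed.

End EulerPoincare.

(** Rank-nullity splits each face count into cycles and the boundaries one degree lower; the
    boundary dimensions cancel between consecutive degrees. *)
Lemma euler_poincare (k : fieldType) (W : finType) (K L : {set {set W}}) N :
  (forall F G H : {set W}, F \in K :\: L -> H \in K :\: L -> F \subset G -> G \subset H ->
     G \in K :\: L) ->
  (#|W| < N)%N ->
  \sum_(F in K :\: L) (-1) ^+ #|F| =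
  \sum_(n < N) (-1) ^+ n * (rel_betti k K L n)%:Z :> int.
Proof.
move=> A_convex WN; rewrite (sum_sign_card _ WN).
case: N WN => // N WN.
set A := K :\: L in A_convex *.
(* The added term is zero, as no face has more than [#|W|] vertices. With it the identity holds for
   every [N], so induction applies. *)
have -> : \sum_(n < N.+1) (-1) ^+ n * (rel_betti k K L n)%:Z =
    \sum_(n < N.+1) (-1) ^+ n * (rel_betti k K L n)%:Z +
    (-1) ^+ N * (\dim (boundaries k A N))%:Z :> int.
  have -> : \dim (boundaries k A N) = 0%N.
    apply/eqP; rewrite -leqn0.
    apply: (@leq_trans (\dim (chains k A N.+1))).
      by rewrite -(limg_ker_dim (boundary k A) (chains k A _)) leq_addl.
    rewrite dim_chains leqn0 cards_eq0; apply/eqP/setP => F; rewrite !inE.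
    by apply/negbTE/negP => /andP [_ /eqP FN]; move: (max_card F); lia.
  by rewrite mulr0 addr0.
elim: {WN} N => [|N IHN].
  rewrite !big_ord_recr !big_ord0 /= -(dim_cycles_boundary k A 0).
  rewrite boundary_chains0 dimv0 !expr0 /rel_betti -/A.
  by move: (dimvS (boundaries_sub_cycles k A_convex 0)); lia.
rewrite big_ord_recr /= IHN [in RHS]big_ord_recr /=.
rewrite -(dim_cycles_boundary k A N.+1) -/(boundaries k A N) exprS.
(* Boundaries are cycles, so the truncated subtraction in [rel_betti] is exact. *)
have := dimvS (boundaries_sub_cycles k A_convex N.+1).
rewrite /rel_betti -/A => /subnKC {1}<-; rewrite !PoszD; ring.
Qed.

(** * Alternating sums over Boolean intervals *)

Lemma sum_sign_toggle (W : finType) (v : W) (P : pred {set W}) :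
  (forall F : {set W}, v \notin F -> P (v |: F) = P F) ->
  \sum_(F : {set W} | P F) (-1) ^+ #|F| = 0 :> int.
Proof.
move=> Pv; rewrite (bigID (fun F : {set W} => v \in F)) /=.
(* A set containing [v] is [v |: F] with [v] outside [F], and it cancels against [F]. *)
rewrite (reindex_onto (fun F => v |: F) (fun F => F :\ v)) /=; last first.
  by move=> F /andP [_ vF]; rewrite setD1K.
rewrite (eq_bigl (fun F : {set W} => P F && (v \notin F))); last first.
  move=> F; rewrite setU11 andbT; have [vF | vF] := boolP (v \in F).
    rewrite andbF; apply/negbTE; rewrite negb_and; apply/orP; right.
    by apply: contraTneq vF => <-; rewrite setD11.
  by rewrite setU1K // eqxx !andbT Pv.
rewrite -big_split /= big1 // => F /andP [_ vF].
by rewrite cardsU1 vF exprS mulN1r addNr.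
Qed.

Lemma sum_sign_interval (W : finType) (F G : {set W}) : F \proper G ->
  \sum_(H : {set W} | (F \subset H) && (H \subset G)) (-1) ^+ #|H| = 0 :> int.
Proof.
case/properP=> FG [v vG vF]; apply: (sum_sign_toggle (v := v)) => H vH.
rewrite subUset sub1set vG /=; congr (_ && _).
apply/idP/idP => [/subsetP FH | FH]; last exact: (subset_trans FH (subsetUr _ _)).
apply/subsetP => u uF; have := FH u uF; rewrite !inE.
by case: eqVneq => // uv; rewrite uv (negbTE vF) in uF.
Qed.

Lemma sum_sign_subset (W : finType) (G : {set W}) :
  \sum_(H : {set W} | H \subset G) (-1) ^+ #|H| = (G == set0)%:R :> int.
Proof.
case: (set_0Vmem G) => [-> | [v vG]].
  rewrite eqxx (big_pred1 set0) ?cards0 // => H; exact: subset0.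
have -> : (G == set0) = false by apply: contraTF vG => /eqP ->; rewrite inE.
rewrite -[RHS](@sum_sign_interval _ set0 G); last first.
  by rewrite proper0; apply/set0Pn; exists v.
by apply: eq_bigl => H; rewrite sub0set.
Qed.

(** * Chains in a finite poset and Moebius inversion *)

Section ChainSum.
Variables (P : finType) (le : rel P) (A : {set P}).
Hypotheses (le_refl : reflexive le) (le_anti : antisymmetric le).
Hypothesis le_trans : {in A & &, transitive le}.

Definition order_chain (t : {set P}) : bool :=
  [forall x in t, forall y in t, le x y || le y x].

Definition strict_upper (x : P) : {set P} := [set y in A | le x y & y != x].

(** The empty chain counts, so this is minus the reduced Euler characteristic of the order complex
    of [B]. *)
Definition chain_sum (B : {set P}) : int :=
  \sum_(t : {set P} | (t \subset B) && order_chain t) (-1) ^+ #|t|.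

Lemma order_chainP (t : {set P}) :
  reflect {in t &, forall x y, le x y || le y x} (order_chain t).
Proof.
apply: (iffP forall_inP) => [H x y xt yt | H x xt].
  exact: (forall_inP (H x xt)).
by apply/forall_inP => y yt; apply: H.
Qed.

Lemma chain_min (t : {set P}) : t \subset A -> order_chain t -> t != set0 ->
  exists2 x, x \in t & {in t, forall y, le x y}.
Proof.
move=> /subsetP tA /order_chainP tC /set0Pn [x0 x0t].
(* The least element is the one with the most elements of [t] above it: if [x] were not below [y],
   then [y] would have strictly more. *)
case: (@arg_maxnP _ x0 (mem t) (fun x => #|[set z in t | le x z]|) x0t) => x xt xmax.
exists x => // y yt; apply: contraT => xy.
have yx : le y x by have := tC x y xt yt; rewrite (negbTE xy).
suff : [set z in t | le x z] \proper [set z in t | le y z].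
  by move/proper_card; rewrite ltnNge; move/negP; case; apply: xmax.
apply/properP; split; last by exists y; rewrite !inE ?yt ?le_refl ?(negbTE xy) ?andbF.
apply/subsetP => z; rewrite !inE => /andP [zt xz]; rewrite zt /=.
exact: (le_trans (tA _ xt) (tA _ yt) (tA _ zt)).
Qed.

(** Nonempty chains are sorted by their least element [y]; removing [y] flips the sign and leaves a
    chain strictly above [y]. *)
Lemma chain_sum_upper x : x \in A ->
  chain_sum (strict_upper x) = 1 - \sum_(y in strict_upper x) chain_sum (strict_upper y).
Proof.
move=> xA; rewrite /chain_sum (bigD1 set0) /=; last first.
  by rewrite sub0set; apply/order_chainP => ?; rewrite inE.
rewrite cards0 expr0; congr (_ + _).
pose least (t : {set P}) y := (y \in t) && [forall z in t, le y z].
(* The default [x] is never taken on the nonempty chains considered, by [pminP]. *)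
pose pmin t := odflt x [pick y | least t y].
have pminP (t : {set P}) : t \subset strict_upper x -> order_chain t -> t != set0 ->
    least t (pmin t).
  move=> tx tC t0; rewrite /pmin; case: pickP => //= H.
  have tA : t \subset A by apply: subset_trans tx _; apply/subsetP => y; rewrite inE => /andP [].
  have [y yt Hy] := chain_min tA tC t0.
  by have /negP [] := negbT (H y); rewrite /least yt /=; apply/forall_inP.
rewrite (partition_big pmin (mem (strict_upper x))) /=; last first.
  move=> t /andP [/andP [tx tC] t0]; have /andP [pt _] := pminP t tx tC t0.
  exact: (subsetP tx).
rewrite -sumrN; apply: eq_bigr => y yx; rewrite -sumrN.
have yt_leq (t : {set P}) : t \subset strict_upper y -> y \notin t.
  by move=> /subsetP ty; apply/negP => /ty; rewrite inE eqxx /= !andbF.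
rewrite (reindex_onto (fun t => y |: t) (fun t => t :\ y)) /=; last first.
  move=> t /andP [/andP [/andP [tx tC] t0] /eqP pt]; rewrite setD1K // -pt.
  by have /andP [] := pminP t tx tC t0.
move: (yx); rewrite inE => /and3P [yA xy nyx].
rewrite (eq_bigl (fun t : {set P} => (t \subset strict_upper y) && order_chain t)).
  by apply: eq_bigr => t /andP [/yt_leq yt _]; rewrite cardsU1 yt exprS mulN1r.
move=> t; apply/idP/idP.
  case/andP=> /andP [/andP [/andP [tx tC] t0] /eqP pt] /eqP tE.
  have yt : y \notin t by rewrite -tE setD11.
  have /andP [_ /forall_inP] := pminP _ tx tC t0; rewrite pt => ymin.
  apply/andP; split.
    apply/subsetP => z zt; have ztU : z \in y |: t by rewrite inE zt orbT.
    move/subsetP/(_ z ztU): tx; rewrite !inE (ymin z ztU) => /and3P [-> _ _] /=.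
    by apply: contraNneq yt => <-.
  apply/order_chainP => u v ut vt; apply: (order_chainP _ tC).
    by rewrite inE ut orbT.
  by rewrite inE vt orbT.
case/andP=> ty tC; have yt := yt_leq t ty; rewrite setU1K // eqxx andbT.
have tyP z : z \in t -> [/\ z \in A, le y z & z != y].
  by move/(subsetP ty); rewrite inE => /and3P.
have yx' : y |: t \subset strict_upper x.
  rewrite subUset sub1set yx /=; apply/subsetP => z /tyP [zA yz zy].
  rewrite inE zA (le_trans yA xA zA xy yz) /=.
  by apply: contraNneq nyx => zx; apply/eqP/le_anti; rewrite xy -zx yz.
have yC : order_chain (y |: t).
  apply/order_chainP => u v; rewrite !inE.
  case/predU1P=> [-> | ut] /predU1P [-> | vt]; rewrite ?le_refl //.
  - by have [_ ->] := tyP v vt.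
  - by have [_ ->] := tyP u ut; rewrite orbT.
  - exact: (order_chainP _ tC).
have y0 : y |: t != set0 by apply/set0Pn; exists y; rewrite setU11.
rewrite yx' yC y0 /=.
have /andP [pt /forall_inP pmin_le] := pminP _ yx' yC y0.
apply/eqP/le_anti; rewrite (pmin_le y) ?setU11 //=.
move: pt; rewrite !inE => /predU1P [-> | /tyP [] //]; exact: le_refl.
Qed.

(* Moebius inversion: by [chain_sum_upper], the function [chain_sum (strict_upper _)]
   is the inverse image of the constant 1 under the zeta function, while Eulerian
   intervals have Moebius function [(-1) ^ (rho y - rho x)]. *)
Lemma chain_sum_eulerian (rho : P -> nat) x : x \in A ->
  (forall y, y \in strict_upper x ->
     \sum_(z in A | le x z && le z y) (-1) ^+ rho z = 0 :> int) ->
  \sum_(z in A | le x z) (-1) ^+ rho z =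
  (-1) ^+ rho x * chain_sum (strict_upper x) :> int.
Proof.
move=> xA euler.
have one z : z \in A -> \sum_(y in A | le z y) chain_sum (strict_upper y) = 1.
  move=> zA; rewrite (bigD1 z) ?zA ?le_refl //= (chain_sum_upper zA).
  rewrite (eq_bigl (mem (strict_upper z))) ?subrK // => y.
  by rewrite !inE andbA.
transitivity (\sum_(z in A | le x z) \sum_(y in A | le z y)
    (-1) ^+ rho z * chain_sum (strict_upper y)).
  by apply: eq_bigr => z /andP [zA _]; rewrite -mulr_sumr one // mulr1.
(* After the exchange [z] runs over the interval from [x] to [y], whose sum vanishes by [euler]
   unless [y] is [x]. *)
rewrite (exchange_big_dep (fun y => (y \in A) && le x y)) /=; last first.
  by move=> z y /andP [zA xz] /andP [yA zy]; rewrite yA (le_trans zA xA yA xz zy).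
rewrite (bigD1 x) ?xA ?le_refl //= [X in _ + X]big1 ?addr0.
  rewrite (big_pred1 x) // => z.
  apply/idP/eqP => [/andP [/andP [zA xz] zx] | ->]; last by rewrite xA !le_refl.
  by apply: le_anti; rewrite zx xz.
move=> y /andP [/andP [yA xy] yx]; rewrite -mulr_suml.
rewrite (eq_bigl (fun z => (z \in A) && (le x z && le z y))).
  by rewrite euler ?mul0r // inE yA xy.
by move=> z; rewrite yA /= andbA.
Qed.

End ChainSum.

(** * Alternating sums over the boundary of the cross-polytope *)

Section CrossPolytope.
Variable d : nat.

(** A face takes on each axis no vertex or one of the two antipodes. Coding it as a function of the
    axis lets sums over faces factor into products. *)
Definition cross_face (f : {ffun 'I_d -> option bool}) : {set 'I_d * bool} :=
  [set p | f p.1 == Some p.2].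

Definition cross_coord (F : {set 'I_d * bool}) : {ffun 'I_d -> option bool} :=
  [ffun i => if (i, true) \in F then Some true
             else if (i, false) \in F then Some false else None].

Lemma cross_faceK : cancel cross_face cross_coord.
Proof.
by move=> f; apply/ffunP => i; rewrite ffunE !inE /=; case: (f i) => [[]|].
Qed.

Lemma cross_coordK F : F \in cross_polytope_boundary d ->
  cross_face (cross_coord F) = F.
Proof.
rewrite inE => /forallP FB; apply/setP => -[i b]; rewrite inE ffunE /=.
by have := FB i; case: b; case: (_ \in F) => //; case: (_ \in F).
Qed.

Lemma cross_face_in f : cross_face f \in cross_polytope_boundary d.
Proof. by rewrite inE; apply/forallP => i; rewrite !inE /=; case: (f i) => [[]|]. Qed.

Lemma sum_cross_polytope (Q : pred {set 'I_d * bool})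
    (q : 'I_d -> option bool -> bool) :
  (forall f : {ffun 'I_d -> option bool},
     Q (cross_face f) = [forall i, q i (f i)]) ->
  \sum_(F in cross_polytope_boundary d | Q F) (-1) ^+ #|F| =
  \prod_i ((q i None)%:R - (q i (Some true))%:R - (q i (Some false))%:R) :> int.
Proof.
move=> Qq; rewrite (reindex_onto cross_face cross_coord) /=; last first.
  by move=> F /andP [/cross_coordK].
(* The contribution of axis [i]: a sign for a chosen vertex, times the indicator of the condition
   there. *)
pose w i (o : option bool) : int := (-1) ^+ (o != None) * (q i o)%:R.
transitivity (\sum_(f : {ffun 'I_d -> option bool}) \prod_i w i (f i)).
  rewrite big_mkcond /=; apply: eq_bigr => f _.
  rewrite cross_face_in cross_faceK eqxx andbT /= Qq.
  rewrite /w big_split /= prodrXr.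
  have -> : (\sum_i (f i != None))%N = #|cross_face f|.
    transitivity (\sum_i \sum_(b : bool) ((i, b) \in cross_face f))%N.
      by apply: eq_bigr => i _; rewrite big_bool !inE /=; case: (f i) => [[]|].
    rewrite pair_big /= -sum1_card [RHS]big_mkcond /=.
    by apply: eq_bigr => -[i b] _; case: ifP.
  case: (boolP [forall i, q i (f i)]) => [/forallP H | /forallPn [i /negbTE Hi]].
    by rewrite [X in _ * X]big1 ?mulr1 // => i _; rewrite H.
  by rewrite [X in _ * X](bigD1 i) //= Hi mul0r mulr0.
rewrite -bigA_distr_bigA; apply: eq_bigr => i _.
rewrite (bigD1 None) // (bigD1 (Some true)) // (bigD1 (Some false)) //=.
by rewrite big_pred0 => [|[[]|]] //; rewrite /w /=; ring.
Qed.

(** Every axis gives the factor -1: an axis meeting [G] allows only its vertex in [G], and any other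
    axis gives 1 - 1 - 1. *)
Lemma sum_cross_polytope_star G : G \in cross_polytope_boundary d ->
  \sum_(F in cross_polytope_boundary d | G \subset F) (-1) ^+ #|F| =
  (-1) ^+ d :> int.
Proof.
rewrite inE => /forallP GB.
rewrite (sum_cross_polytope (q := fun i o => [forall b, ((i, b) \in G) ==> (o == Some b)])).
  rewrite (eq_bigr (fun=> -1)) ?prodr_const ?card_ord // => i _.
  have allb (p : pred bool) : [forall b, p b] = p true && p false.
    by apply/forallP/andP => [H | [Ht Hf] []].
  by have := GB i; rewrite !allb; case: (_ \in G); case: (_ \in G).
move=> f; apply/subsetP/forallP => [H i | H [i b] ib].
  by apply/forallP => b; apply/implyP => /H; rewrite inE.
by rewrite inE; have /forallP/(_ b) := H i; rewrite ib.
Qed.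

(** An axis gives 1 - 1 - 1 if its colour is in [T] and 1 otherwise; each colour belongs to exactly
    one axis. *)
Lemma sum_cross_polytope_color (T : {set 'I_d}) (col : 'I_d * bool -> 'I_d) :
  (forall i, col (i, true) = col (i, false)) ->
  injective (fun i => col (i, true)) ->
  \sum_(F in cross_polytope_boundary d | col @: F \subset T) (-1) ^+ #|F| =
  (-1) ^+ #|T| :> int.
Proof.
move=> col_antipodal col_inj.
rewrite (sum_cross_polytope (q := fun i o =>
  if o is Some b then col (i, b) \in T else true)); last first.
  move=> f; apply/subsetP/forallP => [H i | H _ /imsetP [[i b] + ->]].
    case fi : (f i) => [b|] //; apply: H; apply: imset_f.
    by rewrite inE fi.
  by rewrite inE => /eqP /= fi; have := H i; rewrite fi.
rewrite -prodr_const [RHS]big_mkcond [RHS](reindex_inj col_inj) /=.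
by apply: eq_bigr => i _; rewrite -col_antipodal; case: (_ \in T).
Qed.


End CrossPolytope.

(** * Boundary complexes of the d-cells *)

Section CrossComplexEuler.
Variables (V : finType) (d : nat) (X : cross_complex V d).
Implicit Types (F G : {set V}) (B : {set {set V}}) (x y z : face V).

Lemma cross_boundary_sub (F G : {set 'I_d * bool}) :
  G \in cross_polytope_boundary d -> F \subset G -> F \in cross_polytope_boundary d.
Proof.
rewrite !inE => /forallP GB /subsetP FG; apply/forallP => i.
by apply: contra (GB i) => /andP [/FG -> /FG ->].
Qed.

Lemma cross_boundary_pair (p q : 'I_d * bool) : p.1 != q.1 ->
  [set p; q] \in cross_polytope_boundary d.
Proof.
move=> pq; rewrite inE; apply/forallP => i; apply: contra pq.
case: p q => [i1 b1] [i2 b2]; rewrite !inE !xpair_eqE.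
by case: (i =P i1) => [->|_]; case: (_ =P i2) => //=; case: b1; case: b2.
Qed.

Lemma dcell_sub B F G : B \in dcells X -> G \in B -> F \subset G -> F \in B.
Proof.
move=> /dcell_boundary_cross [phi phi_inj ->] /imsetP [G' G'B ->] /subsetP FG.
apply/imsetP; exists (G' :&: phi @^-1: F).
  exact: (cross_boundary_sub G'B (subsetIl _ _)).
apply/setP => v; apply/idP/imsetP => [vF | [p + ->]]; last by rewrite !inE => /andP [].
by have /imsetP [p pG vp] := FG v vF; exists p => //; rewrite !inE pG -vp.
Qed.

Lemma set0_dcell B : B \in dcells X -> set0 \in B.
Proof.
move=> /dcell_boundary_cross [phi phi_inj ->]; apply/imsetP; exists set0.
  by rewrite inE; apply/forallP => i; rewrite !inE.
by rewrite imset0.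
Qed.

Lemma card_cover_dcell B : B \in dcells X -> #|cover B| = d.*2.
Proof.
move=> /dcell_boundary_cross [phi phi_inj ->].
have -> : cover [set phi @: (F : {set _}) | F in cross_polytope_boundary d] = phi @: setT.
  apply/setP => v; apply/bigcupP/imsetP => [[_ /imsetP [F _ ->] /imsetP [p _ ->]] | [p _ ->]].
    by exists p.
  exists (phi @: [set p]); last by rewrite imset_f ?set11.
  apply: imset_f; rewrite inE; apply/forallP => i; rewrite !inE.
  by apply/negP => /andP [/eqP <-]; rewrite xpair_eqE andbF.
by rewrite card_imset // cardsT card_prod card_bool card_ord muln2.
Qed.

Lemma sum_dcell_star B G : B \in dcells X -> G \in B ->
  \sum_(F in B | G \subset F) (-1) ^+ #|F| = (-1) ^+ d :> int.
Proof.
move=> /dcell_boundary_cross [phi phi_inj ->] /imsetP [G' G'B ->].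
rewrite big_imset_cond /=; last by move=> F F' _ _; apply: imset_inj.
rewrite -[RHS](sum_cross_polytope_star G'B); apply: eq_big => [F | F _].
  congr (_ && _); apply/idP/idP => [/subsetP H | ]; last exact: imsetS.
  apply/subsetP => p pG; have := H (phi p) (imset_f _ pG).
  by rewrite mem_imset.
by rewrite card_imset.
Qed.

Lemma sum_dcell_color (kappa : V -> 'I_d) (T : {set 'I_d}) B :
  B \in dcells X -> (forall F, F \in B -> {in F &, injective kappa}) ->
  \sum_(F in B | kappa @: F \subset T) (-1) ^+ #|F| = (-1) ^+ #|T| :> int.
Proof.
move=> /dcell_boundary_cross [phi phi_inj BE] kappa_inj.
pose col p := kappa (phi p).
have col_neq p q : p.1 != q.1 -> col p != col q.
  move=> pq; apply: contra_neq pq => pq.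
  case: (eqVneq p.1 q.1) => // npq.
  have pqB : phi @: [set p; q] \in B.
    by rewrite BE; apply: imset_f; exact: cross_boundary_pair.
  have /phi_inj -> // : phi p = phi q.
  by apply: (kappa_inj _ pqB) => //; apply: imset_f; rewrite !inE eqxx ?orbT.
have col_inj : injective (fun i => col (i, true)).
  by move=> i j /eqP; apply: contraTeq; apply: (col_neq (i, true) (j, true)).
(* The vertices [(i, true)] use all d colours, and [(i, false)] is joined by an edge to each of them
   except its antipode, whose colour it must share. *)
have col_antipodal i : col (i, true) = col (i, false).
  have [g _ gK] := injF_bij col_inj.
  have := gK (col (i, false)); have [-> // | ij] := eqVneq (g (col (i, false))) i.
  by move/eqP; rewrite (negbTE (col_neq (_, _) (_, _) ij)).
rewrite BE big_imset_cond /=; last by move=> F F' _ _; apply: imset_inj.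
rewrite -[RHS](sum_cross_polytope_color T col_antipodal col_inj).
by apply: eq_big => [F | F _]; rewrite ?card_imset // -imset_comp.
Qed.

(** * The face poset and its Eulerian intervals *)

Lemma face_le_refl : reflexive (@face_le V).
Proof. by case=> [F | B] /=. Qed.

Lemma face_le_anti : antisymmetric (@face_le V).
Proof.
case=> [F | B] [G | B'] //=; rewrite ?andbF //; last by move=> /andP [/eqP ->].
by rewrite -eqEsubset => /eqP ->.
Qed.

Lemma face_le_trans : {in faces X & &, transitive (@face_le V)}.
Proof.
case=> [G | B'] [F | B] [H | B''] //=; rewrite !inE => gX fX hX.
- exact: subset_trans.
- by move=> FG GB; apply: (dcell_sub hX GB FG).
- by move=> FB /eqP <-.
- by move=> /eqP -> /eqP ->.
Qed.

Lemma face_le0 x : x \in faces X -> face_le (inl set0) x.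
Proof. by case: x => [F | B] /=; rewrite inE ?sub0set //; apply: set0_dcell. Qed.

Lemma sum_faces (Q : pred (face V)) :
  \sum_(z in faces X | Q z) (-1) ^+ face_rank d z =
  \sum_(F in skel X | Q (inl F)) (-1) ^+ #|F| +
  \sum_(B in dcells X | Q (inr B)) (-1) ^+ d.+1 :> int.
Proof.
by rewrite big_sumType /=; congr (_ + _); apply: eq_bigl => ?; rewrite inE.
Qed.

(** The intervals are Eulerian: those below a simplex are Boolean, and below a d-cell the star in
    its boundary contributes (-1)^d, cancelled by the cell itself. *)
Lemma sum_star_chain_sum F : F \in skel X ->
  \sum_(G in skel X | F \subset G) (-1) ^+ #|G| +
  \sum_(B in dcells X | F \in B) (-1) ^+ d.+1 =
  (-1) ^+ #|F| * chain_sum (@face_le V) (strict_upper (@face_le V) (faces X) (inl F))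
  :> int.
Proof.
move=> FX; have FfX : inl F \in faces X by rewrite inE.
rewrite -(sum_faces (face_le (inl F))).
apply: (chain_sum_eulerian face_le_refl face_le_anti face_le_trans (rho := face_rank d) FfX).
move=> y; rewrite inE => /and3P [+ Fy yF].
rewrite (sum_faces (fun z => face_le (inl F) z && face_le z y)).
case: y Fy yF => [G | B] /= Fy yF; rewrite inE => yX.
  rewrite [X in _ + X]big_pred0 ?addr0 => [|B]; last by rewrite !andbF.
  rewrite -[RHS](@sum_sign_interval _ F G); last first.
    by rewrite properEneq Fy andbT eq_sym; apply: contraNneq yF => ->.
  apply: eq_bigl => H; case: (boolP (H \subset G)) => HG; rewrite ?andbF //.
  by rewrite (proj2 (skel_complex X) _ _ yX HG).
rewrite (eq_bigl (fun H : {set V} => (H \in B) && (F \subset H))); last first.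
  move=> H; rewrite andbCA; case: (boolP (H \in B)) => HB; rewrite ?andbF //.
  by rewrite (subsetP (dcell_boundary_sub yX) _ HB) !andbT.
rewrite sum_dcell_star // (big_pred1 B) ?exprS ?mulN1r ?addrN // => B'.
by rewrite /=; case: (eqVneq B' B) => [-> | _]; rewrite ?andbF // yX Fy.
Qed.

Lemma subdivision_sub (s t : {set face V}) :
  t \in subdivision X -> s \subset t -> s \in subdivision X.
Proof.
rewrite !inE => /andP [tX /order_chainP tC] st; rewrite (subset_trans st tX) /=.
by apply/order_chainP => x y xs ys; apply: tC; apply: (subsetP st).
Qed.

(** Euler-Poincare on the whole subdivision, whose vertices are exactly the faces strictly above the
    empty one. *)
Lemma acyclic_chain_sum (k : fieldType) :
  (forall n, red_betti k (subdivision X) n = 0%N) ->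
  chain_sum (@face_le V) (strict_upper (@face_le V) (faces X) (inl set0)) = 0.
Proof.
move=> acyc.
have euler := @euler_poincare k _ (subdivision X) set0 #|face V|.+1 _ (leqnn _).
rewrite setD0 in euler.
have -> : strict_upper (@face_le V) (faces X) (inl set0) = faces X :\ inl set0.
  apply/setP => x; rewrite inE in_setD1 andbC.
  by case: (boolP (x \in faces X)) => xX; rewrite ?andbF // face_le0.
transitivity (\sum_(t in subdivision X) (-1) ^+ #|t| : int).
  by apply: eq_bigl => t; rewrite inE.
rewrite euler; last by move=> s t u _ uX _; apply: subdivision_sub uX.
by apply: big1 => n _; rewrite -/(red_betti k (subdivision X) n) acyc mulr0.
Qed.

(** * Local homology at the faces of the boundary *)

Definition initial_segment F (v : V) : {set V} :=
  [set u in F | (enum_rank u <= enum_rank v)%N].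

(** A maximal chain of nonempty faces of [F], adding vertices in enumeration order. For nonempty [F]
    it is a carrier in the relative interior of [F]. *)
Definition full_flag F : {set face V} :=
  [set inl (initial_segment F v) | v in F].

Lemma initial_segment_sub F v : initial_segment F v \subset F.
Proof. by apply/subsetP => u; rewrite inE => /andP []. Qed.

Lemma full_flag_chain F : order_chain (@face_le V) (full_flag F).
Proof.
apply/order_chainP => _ _ /imsetP [v _ ->] /imsetP [w _ ->] /=.
apply/orP; case: (leqP (enum_rank v) (enum_rank w)) => [vw | /ltnW wv]; [left | right].
  by apply/subsetP => u; rewrite !inE => /andP [-> /leq_trans ->].
by apply/subsetP => u; rewrite !inE => /andP [-> /leq_trans ->].
Qed.

Lemma full_flag_top F : F != set0 -> inl F \in full_flag F.
Proof.
case/set0Pn=> v0 v0F.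
case: (@arg_maxnP _ v0 (mem F) (fun v => enum_rank v : nat) v0F) => v vF vmax.
apply/imsetP; exists v => //; congr inl; apply/setP => u; rewrite inE.
by case: (boolP (u \in F)) => //= uF; apply/esym; apply: vmax.
Qed.

Lemma full_flag_face F x : F \in skel X -> x \in full_flag F ->
  [/\ x \in faces X, x != inl set0 & face_le x (inl F)].
Proof.
move=> FX /imsetP [v vF ->]; split; last exact: initial_segment_sub.
  by rewrite inE; apply: (proj2 (skel_complex X) _ _ FX (initial_segment_sub _ _)).
by apply/eqP => -[/setP /(_ v)]; rewrite !inE vF leqnn.
Qed.

(** A nonempty [G] inside [F] is the segment ending at its last vertex [v]: for [u] in [F] before
    [v], the segment of [u] misses [v], so it cannot contain [G] and must lie in [G]. *)
Lemma full_flag_maximal F x : x != inl set0 -> F != set0 ->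
  {in full_flag F, forall y, face_le x y || face_le y x} ->
  x \in full_flag F \/ face_le (inl F) x.
Proof.
move=> x0 F0 cmp; have /orP [xF | ] := cmp _ (full_flag_top F0); last by right.
left; case: x x0 cmp xF => [G | B] //= G0 cmp GF.
have /set0Pn [v0 v0G] : G != set0 by apply: contraNneq G0 => ->.
case: (@arg_maxnP _ v0 (mem G) (fun v => enum_rank v : nat) v0G) => v vG vmax.
have vF := subsetP GF v vG.
apply/imsetP; exists v => //; congr inl; apply/setP => u; rewrite inE.
apply/idP/andP => [uG | [uF uv]]; first by split; [exact: (subsetP GF) | exact: vmax].
have [-> // | nuv] := eqVneq u v.
have {}uv : (enum_rank u < enum_rank v)%N.
  by rewrite ltn_neqAle uv andbT; apply: contra nuv => /eqP /val_inj /enum_rank_inj ->.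
have /orP [/subsetP /(_ v vG) | /subsetP] := cmp _ (imset_f (fun v => inl (initial_segment F v)) uF).
  by rewrite inE leqNgt uv andbF.
by apply; rewrite inE uF leqnn.
Qed.

(* Chains through a full flag of F are only extended above F, so the local homology
   at a point carried by the flag sees the poset of faces above F alone. *)
Lemma boundary_chain_sum (k : fieldType) F : F != set0 -> F \in skel X ->
  boundary_face X k (inl F) ->
  chain_sum (@face_le V) (strict_upper (@face_le V) (faces X) (inl F)) = 0.
Proof.
move=> F0 FX [FfX bdF]; set s := full_flag F.
have sX : s \in subdivision X.
  rewrite inE; apply/andP; split; last exact: full_flag_chain.
  by apply/subsetP => x /(full_flag_face FX) [xX x0 _]; rewrite in_setD1 x0.
have Fs : inl F \in s := full_flag_top F0.
have {}bdF n : local_betti X k s n = 0%N.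
  apply: bdF; split=> //.
    by split=> //; apply/set0Pn; exists (inl F).
  by move=> y /(full_flag_face FX) [].
(* The simplices outside [L] are the chains containing the whole flag, the open star of the
   carrier. *)
set L := [set t in subdivision X | ~~ (s \subset t)] in bdF.
have LE t : (t \in subdivision X :\: L) = (t \in subdivision X) && (s \subset t).
  by rewrite [LHS]inE [t \in L]inE negb_and negbK andbC; case: (t \in _).
have euler := @euler_poincare k _ (subdivision X) L #|face V|.+1 _ (leqnn _).
suff E : \sum_(t in subdivision X :\: L) (-1) ^+ #|t| = (-1) ^+ #|s| *
    chain_sum (@face_le V) (strict_upper (@face_le V) (faces X) (inl F)) :> int.
  have : (-1) ^+ #|s| *
      chain_sum (@face_le V) (strict_upper (@face_le V) (faces X) (inl F)) = 0.
    rewrite -E euler; first by apply: big1 => n _; rewrite [rel_betti _ _ _ _]bdF mulr0.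
    move=> t u w; rewrite !LE => /andP [_ st] /andP [wX _] tu uw.
    by rewrite (subdivision_sub wX uw) (subset_trans st tu).
  by move/eqP; rewrite mulf_eq0 signr_eq0 => /eqP.
(* By [full_flag_maximal], such a chain is the flag together with a chain strictly above [F]. *)
rewrite (reindex_onto (fun t => s :|: t) (fun t => t :\: s)) /=; last first.
  by move=> t; rewrite LE => /andP [_ st]; rewrite setDE setUIr setUCr setIT; apply/setUidPr.
have upper_notin (t : {set face V}) :
    t \subset strict_upper (@face_le V) (faces X) (inl F) -> [disjoint s & t].
  move=> /subsetP tF; rewrite disjoint_subset; apply/subsetP => x xs.
  apply/negP => /tF; rewrite inE => /and3P [_ Fx /eqP]; apply.
  by apply: face_le_anti; rewrite Fx; have [_ _ ->] := full_flag_face FX xs.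
rewrite /chain_sum mulr_sumr.
rewrite (eq_bigl (fun t : {set face V} =>
  (t \subset strict_upper (@face_le V) (faces X) (inl F)) && order_chain (@face_le V) t)).
  apply: eq_bigr => t /andP [/upper_notin st _].
  by rewrite cardsU (disjoint_setI0 st) cards0 subn0 exprD.
move=> t; rewrite LE subsetUl andbT; apply/idP/idP.
  case/andP; rewrite inE => /andP [/subsetP tX /order_chainP tC] /eqP tE.
  apply/andP; split; last first.
    by apply/order_chainP => x y xt yt; apply: tC; rewrite inE ?xt ?yt orbT.
  apply/subsetP => x xt; have xst : x \in s :|: t by rewrite inE xt orbT.
  have := tX x xst; rewrite in_setD1 => /andP [x0 xX].
  have xs : x \notin s by move: xt; rewrite -tE inE => /andP [].
  have [xs' | Fx] : x \in full_flag F \/ face_le (inl F) x.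
  - by apply: full_flag_maximal => // y ys; apply: tC => //; rewrite inE ys.
  - by rewrite /s xs' in xs.
  by rewrite inE xX Fx /=; apply: contraNneq xs => ->.
case/andP=> tF tC; have st := upper_notin t tF.
rewrite setDUl setDv set0U; have -> : t :\: s = t by apply/setDidPl; rewrite disjoint_sym.
rewrite eqxx andbT inE; apply/andP; split.
  move: sX; rewrite inE subUset => /andP [-> _] /=.
  apply/subsetP => x /(subsetP tF); rewrite inE => /and3P [xX Fx xF].
  rewrite in_setD1 xX andbT; apply: contra F0 => /eqP x0.
  by move: Fx; rewrite x0 /= subset0.
have cross u v : u \in s -> v \in t -> face_le u v.
  move=> us /(subsetP tF); rewrite inE => /and3P [vX Fv _].
  have [uX _ uF] := full_flag_face FX us.
  exact: (face_le_trans FfX uX vX uF Fv).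
apply/order_chainP => u v; rewrite !inE => /orP [us | ut] /orP [vs | vt].
- exact: (order_chainP _ _ (full_flag_chain F)).
- by rewrite cross.
- by rewrite (cross v u) ?orbT.
- exact: (order_chainP _ _ tC).
Qed.

Lemma boundary_face_euler (k : fieldType) F :
  (forall n, red_betti k (subdivision X) n = 0%N) ->
  boundary_face X k (inl F) ->
  \sum_(G in skel X | F \subset G) (-1) ^+ #|G| =
  \sum_(B in dcells X | F \in B) (-1) ^+ d :> int.
Proof.
move=> acyc bdF; have FX : F \in skel X by case: bdF; rewrite inE.
apply/eqP; rewrite -subr_eq0 -sumrN; apply/eqP.
have := sum_star_chain_sum FX.
under [X in _ + X]eq_bigr => B _ do rewrite exprS mulN1r.
(* The empty face has no points, so its case rests on global acyclicity instead of local
   homology. *)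
move=> ->; have [-> | F0] := eqVneq F set0.
  by rewrite (acyclic_chain_sum acyc) mulr0.
by rewrite (boundary_chain_sum F0 FX bdF) mulr0.
Qed.

End CrossComplexEuler.

(** * Colour sums, flag h-numbers and the Dehn-Sommerville symmetry *)

Section ColorSum.
Variables (V : finType) (d : nat) (kappa : V -> 'I_d).
Implicit Types (K D : {set {set V}}) (T : {set 'I_d}).

Definition color_sum K T : int :=
  \sum_(F in K | kappa @: F \subset T) (-1) ^+ #|F|.

(** Faces are grouped by colour set; balancedness makes the size of a face equal to that of its
    colour set, so the signs agree. *)
Lemma flag_h_color_sum D T : balanced D kappa ->
  flag_h D kappa T = (-1) ^+ #|T| * color_sum D T.
Proof.
move=> bal; rewrite /color_sum mulr_sumr.
rewrite [RHS](partition_big (fun F : {set V} => kappa @: F) (fun S => S \subset T)) /=; last first.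
  by move=> F /andP [].
apply: eq_bigr => S ST; rewrite (eq_bigr (fun=> (-1) ^+ (#|T| - #|S|))).
  rewrite sumr_const -mulr_natr natz; congr (_ * Posz _).
  apply: eq_card => F; rewrite inE [RHS]unfold_in /=.
  by case: (eqVneq (kappa @: F) S) => [-> | _]; rewrite ?andbF // ST !andbT.
move=> F /andP [/andP [FD _] /eqP FS].
rewrite -(card_in_imset (bal F FD)) FS -exprD -signr_odd oddD.
by rewrite -[RHS]signr_odd oddB // subset_leq_card.
Qed.

(** For fixed [G] the sum runs over all sets of vertices of [G] coloured in [T]; it vanishes unless
    there are no such vertices. *)
Lemma color_sum_exchange K T : simplicial_complex K ->
  \sum_(F in K | kappa @: F \subset T)
    (-1) ^+ #|F| * (\sum_(G in K | F \subset G) (-1) ^+ #|G|) =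
  color_sum K (~: T).
Proof.
move=> [_ Ksub]; under eq_bigr => F _ do rewrite mulr_sumr.
rewrite (exchange_big_dep (mem K)) /=; last by move=> F G _ /andP [].
rewrite /color_sum big_mkcondr /=; apply: eq_bigr => G GK.
rewrite (eq_bigl (fun F : {set V} => F \subset G :&: kappa @^-1: T)); last first.
  move=> F; rewrite subsetI -sub_imset_pre GK /=.
  case: (boolP (F \subset G)) => FG; rewrite ?andbF //= andbT.
  by rewrite (Ksub _ _ GK FG).
rewrite -mulr_suml sum_sign_subset.
have -> : (G :&: kappa @^-1: T == set0) = (kappa @: G \subset ~: T).
  rewrite setI_eq0 disjoint_subset sub_imset_pre; apply: eq_subset_r => v.
  by rewrite !inE.
by case: ifP; rewrite ?mul1r ?mul0r.
Qed.

End ColorSum.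

Lemma homology_sphere_star (k : fieldType) (V : finType) (d : nat)
    (D : {set {set V}}) (F : {set V}) :
  homology_sphere k d D -> F \in D -> (#|F| <= d)%N ->
  \sum_(G in D | F \subset G) (-1) ^+ #|G| = (-1) ^+ d :> int.
Proof.
move=> [[_ Dsub] sph] FD Fd.
(* The bound exceeds [#|V|], as Euler-Poincare demands, and also [d - #|F|], the one degree where
   the link has homology. *)
have VN : (#|V| < (#|V| + d).+1)%N by rewrite ltnS leq_addr.
have euler := @euler_poincare k _ (link D F) set0 _ _ VN.
rewrite setD0 in euler.
have dF : (d - #|F| < (#|V| + d).+1)%N by lia.
transitivity ((-1) ^+ #|F| * \sum_(G in link D F) (-1) ^+ #|G| : int).
  rewrite mulr_sumr (reindex_onto (fun G : {set V} => F :|: G) (fun G => G :\: F)) /=; last first.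
    by move=> G /andP [_ FG]; rewrite setDE setUIr setUCr setIT; apply/setUidPr.
  rewrite (eq_bigl (mem (link D F))); last first.
    move=> G; rewrite subsetUl andbT !inE andbC; congr (_ && _).
    rewrite setDUl setDv set0U; apply/eqP/idP => [/setDidPl | FG].
      by rewrite disjoint_sym.
    by apply/setDidPl; rewrite disjoint_sym.
  apply: eq_bigr => G; rewrite !inE => /andP [FG _].
  by rewrite cardsU (disjoint_setI0 FG) cards0 subn0 exprD.
rewrite euler => [|G1 G2 G3]; last first.
  rewrite !inE => _ /andP [F3 D3] _ G23.
  rewrite (disjointWr G23 F3) /=; exact: (Dsub _ _ D3 (setUS F G23)).
rewrite (bigD1 (Ordinal dF)) //= big1 ?addr0; last first.
  move=> n ndF; rewrite [rel_betti _ _ _ _]sph // mulrC.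
  rewrite (_ : (n + #|F| == d)%N = false) ?mul0r //.
  apply: contraNF ndF => /eqP nFd; rewrite -(inj_eq val_inj) /=; lia.
by rewrite [rel_betti _ _ _ _]sph // subnK // eqxx mulr1 -exprD subnKC.
Qed.

(** All star sums of a sphere equal (-1)^d. In terms of flag h-numbers this is h_(~T) = h_T. *)
Lemma color_sum_dehn_sommerville (k : fieldType) (V : finType) (d : nat)
    (D : {set {set V}}) (kappa : V -> 'I_d) (T : {set 'I_d}) :
  homology_sphere k d D -> balanced D kappa ->
  color_sum kappa D (~: T) = (-1) ^+ d * color_sum kappa D T.
Proof.
move=> sph bal; rewrite -color_sum_exchange ?(proj1 sph) //; last by case: sph.
rewrite /color_sum mulr_sumr; apply: eq_bigr => F /andP [FD _].
rewrite (homology_sphere_star sph FD) 1?mulrC // -(card_in_imset (bal F FD)).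
by rewrite (leq_trans (max_card _)) ?card_ord.
Qed.

(** * Counting the d-cells of an acyclic complex *)

Section StackedDecomposition.
Variables (k : fieldType) (V : finType) (d : nat) (X : cross_complex V d).
Hypothesis acyc : forall n, red_betti k (subdivision X) n = 0%N.

Lemma color_sum_skel (kappa : V -> 'I_d) (T : {set 'I_d}) :
  balanced (skel X) kappa ->
  (forall F : {set V}, F \in skel X -> kappa @: F \subset T -> boundary_face X k (inl F)) ->
  color_sum kappa (skel X) (~: T) = (-1) ^+ (d + #|T|) * #|dcells X|%:Z.
Proof.
move=> bal bd; rewrite -color_sum_exchange; last exact: skel_complex.
transitivity (\sum_(F in skel X | kappa @: F \subset T)
    \sum_(B in dcells X | F \in B) (-1) ^+ #|F| * (-1) ^+ d : int).
  apply: eq_bigr => F /andP [FX FT]; rewrite -mulr_sumr; congr (_ * _).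
  exact: boundary_face_euler acyc (bd F FX FT).
rewrite (exchange_big_dep (mem (dcells X))) /=; last by move=> F B _ /andP [].
rewrite (eq_bigr (fun=> (-1) ^+ (d + #|T|))).
  by rewrite sumr_const -mulr_natr natz.
(* For one d-cell the sum runs over its boundary faces coloured in [T] and gives (-1)^|T|. *)
move=> B BX; rewrite -mulr_suml exprD mulrC; congr (_ * _).
rewrite -(@sum_dcell_color _ _ X kappa T B BX).
  apply: eq_bigl => F; rewrite BX /=.
  case: (boolP (F \in B)) => FB; rewrite ?andbF //= andbT.
  by rewrite (subsetP (dcell_boundary_sub BX) _ FB).
by move=> F /(subsetP (dcell_boundary_sub BX)) /bal.
Qed.

(* Double count the incidences between vertices and faces. *)
Lemma sum_skel_card :
  (forall F : {set V}, F \in skel X -> (#|F| <= 1)%N -> boundary_face X k (inl F)) ->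
  \sum_(G in skel X) (-1) ^+ #|G| * (#|G|%:Z) =
  (-1) ^+ d * (d.*2 * #|dcells X|)%N%:Z.
Proof.
move=> bd.
(* Summing the Euler identity over all vertices counts each face once per vertex, and each d-cell 2d
   times. *)
transitivity (\sum_(v : V | [set v] \in skel X)
    \sum_(B in dcells X | [set v] \in B) (-1) ^+ d : int).
  rewrite (eq_bigr (fun v => \sum_(G in skel X | [set v] \subset G) (-1) ^+ #|G|)).
    rewrite (exchange_big_dep (mem (skel X))) /=; last by move=> v G _ /andP [].
    apply: eq_bigr => G GX; rewrite sumr_const -mulr_natr natz; congr (_ * Posz _).
    apply: eq_card => v; rewrite [RHS]unfold_in /= GX sub1set /=.
    apply/idP/idP => [vG | /andP [] //]; rewrite vG andbT.
    by apply: (proj2 (skel_complex X) _ _ GX); rewrite sub1set.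
  move=> v vX; apply/esym; apply: boundary_face_euler acyc (bd _ vX _).
  by rewrite cards1.
rewrite (exchange_big_dep (mem (dcells X))) /=; last by move=> v B _ /andP [].
rewrite (eq_bigr (fun=> (-1) ^+ d * (d.*2)%:Z)).
  by rewrite sumr_const -mulr_natr natz -mulrA.
move=> B BX; rewrite sumr_const -mulr_natr natz -(card_cover_dcell BX).
congr (_ * Posz _); apply: eq_card => v; rewrite [LHS]unfold_in /= BX /=.
apply/andP/bigcupP => [[_ vB] | [F FB vF]].
  by exists [set v] => //; rewrite set11.
have vB : [set v] \in B by apply: (dcell_sub BX FB); rewrite sub1set.
by rewrite (subsetP (dcell_boundary_sub BX) _ vB).
Qed.

End StackedDecomposition.

(** * Flag h-numbers of the sphere from the d-cells *)

Theorem theorem5p14 (k : fieldType) (V : finType) (d r : nat)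
    (D : {set {set V}}) (kappa : V -> 'I_d) (X : cross_complex V d)
    (T : {set 'I_d}) :
  (1 <= r <= d)%N ->
  homology_sphere k d D ->
  balanced D kappa ->
  stacked_property k d r D ->
  stacked_decomposition k r D X ->
  (r - 1 <= #|T| <= d - r + 1)%N ->
  flag_h D kappa T = #|dcells X|%:Z.
Proof.
move=> /andP [r_gt0 r_le_d] sph bal _ [[_ acyc _] bdX stk] /andP [T_ge T_le].
have skelD (F : {set V}) : F \in skel X -> (#|F| <= d - r + 1)%N -> F \in D.
  by move=> FX Fr; have [|//|G GD [->]] := stk (inl F); rewrite ?inE.
have skel_bd (F : {set V}) : F \in skel X -> (#|F| <= d - r + 1)%N -> boundary_face X k (inl F).
  by move=> FX Fr; apply/bdX; exists F => //; apply: skelD.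
have D_skel (F : {set V}) : F \in D -> F \in skel X.
  move=> FD; have [|] := (bdX (inl F)).2; first by exists F.
  by rewrite inE.
have cardTC : (#|T| + #|~: T|)%N = d by rewrite cardsC card_ord.
rewrite flag_h_color_sum //.
(* The bounds on [#|T|] give 2r <= d + 2, so d - r + 1 < 2 forces r = d <= 2. *)
have [[d2 r2] | d2r2] : (d = 2 /\ r = 2) \/ (d - r + 1 >= 2 \/ d = 1)%N by lia.
  have T1 : #|T| = 1%N by lia.
  have TC1 : #|~: T| = 1%N by lia.
  have DS := color_sum_dehn_sommerville T sph bal.
  have E1 := sum_skel_card acyc (fun F FX F1 => skel_bd F FX (leq_trans F1 (leq_addl _ _))).
  have bd0 : boundary_face X k (inl set0).
    by apply: skel_bd; rewrite ?cards0 //; case: (skel_complex X).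
  have E0 := boundary_face_euler acyc bd0.
  have {}E0 : \sum_(G in skel X) (-1) ^+ #|G| = (-1) ^+ d * #|dcells X|%:Z :> int.
    rewrite (eq_bigl (mem (skel X))) in E0; last by move=> G; rewrite sub0set andbT.
    rewrite E0 (eq_bigl (mem (dcells X))) => [|B].
      by rewrite sumr_const -mulr_natr natz.
    by rewrite /=; case: (boolP (B \in dcells X)) => // /set0_dcell ->.
  (* [T] and its complement are singletons, so a face with 0, 1 or 2 vertices counts 2, 1 or 0 times
     on the left: the weight is 2 - |F|. A face outside [D] is an edge, of weight 0. *)
  have ES : color_sum kappa D T + color_sum kappa D (~: T) =
      2 * (\sum_(G in skel X) (-1) ^+ #|G|) - \sum_(G in skel X) (-1) ^+ #|G| * #|G|%:Z.
    rewrite /color_sum [X in X + _]big_mkcondr [X in _ + X]big_mkcondr -big_split /=.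
    rewrite mulr_sumr -sumrB big_mkcond [RHS]big_mkcond; apply: eq_bigr => F _.
    have [FX | FX] := boolP (F \in skel X); last first.
      by case: (boolP (F \in D)) => // /D_skel; rewrite (negbTE FX).
    have [FD | FD] := boolP (F \in D); last first.
      have := skel_dim FX; have : ~~ (#|F| <= 1)%N.
        by apply: contra FD => F1; apply: skelD => //; lia.
      rewrite -ltnNge d2 => F1 F2; have -> : #|F| = 2%N by lia.
      by [].
    have cF := card_in_imset (bal F FD).
    have [F0 | F0] := eqVneq #|F| 0%N.
      by move/eqP: F0; rewrite cards_eq0 => /eqP ->; rewrite imset0 !sub0set cards0.
    have [/eqP F1 | F1] := eqVneq #|F| 1%N.
      case/cards1P: F1 => v ->; rewrite imset_set1 !sub1set inE cards1.
      by case: (_ \in T).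
    have F2 : #|F| = 2%N by have := skel_dim FX; lia.
    rewrite /= F2 ifF; last by apply/negP => /subset_leq_card; rewrite cF F2 T1.
    by rewrite ifF //; apply/negP => /subset_leq_card; rewrite cF F2 TC1.
  (* With m cells and e the colour sum of [T], this reads 2e = 2m - 4m, so -e = m. *)
  move: ES; rewrite DS E0 E1 T1; move: (color_sum _ _ _) #|dcells X| => e m.
  by rewrite d2 sqrrN expr1n expr1; lia.
have skel_bal : balanced (skel X) kappa.
  move=> F FX u v uF vF uv; have [// | nuv] := eqVneq u v.
  have uvX : [set u; v] \in skel X.
    apply: (proj2 (skel_complex X) _ _ FX); apply/subsetP => w.
    by rewrite !inE => /orP [] /eqP ->.
  have uv2 : #|[set u; v]| = 2%N by rewrite cards2 nuv.
  (* If d - r + 1 >= 2 the edge lies in [D]; if d = 1 there are no edges. *)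
  case: d2r2 => [dr | d1]; last by have := skel_dim uvX; lia.
  have uvD : [set u; v] \in D by apply: skelD; rewrite ?uv2.
  by apply: (bal _ uvD) => //; rewrite !inE eqxx ?orbT.
have cardF (F : {set V}) (S : {set 'I_d}) : F \in skel X -> kappa @: F \subset S -> (#|F| <= #|S|)%N.
  by move=> FX FS; rewrite -(card_in_imset (skel_bal F FX)) subset_leq_card.
(* The upper bound on [#|T|] makes [D] and [skel X] agree on faces coloured in [T]. The lower bound
   gives [#|~: T| <= d - r + 1], so [color_sum_skel] applies to [~: T]. *)
have -> : color_sum kappa D T = color_sum kappa (skel X) (~: ~: T).
  rewrite setCK; apply: eq_bigl => F; apply/andP/andP => -[FX FT]; split=> //.
    exact: D_skel.
  by apply: skelD => //; apply: leq_trans (cardF _ _ FX FT) T_le.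
rewrite (color_sum_skel acyc skel_bal) => [|F FX FT].
  (* The exponent is [#|T| + (d + #|~: T|)], that is 2d. *)
  rewrite mulrA -exprD -signr_odd.
  rewrite (_ : odd _ = false) ?mul1r // -[in X in (_ + (X + _))%N]cardTC; lia.
by apply: skel_bd => //; apply: leq_trans (cardF _ _ FX FT) _; lia.
Qed.
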